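(* Let $E$ be a finite-dimensional vector space over a field and let $\mathcal{H}\subseteq\mathcal{L}(E)$ satisfy the hyperplane axioms (H1)–(H3). Let $\mathcal{F}_{\mathcal{H}}:=\{\bigcap_{H\in I}H: I\subseteq\mathcal{H}\}$, where the empty intersection is $E$. Then $\mathcal{F}_{\mathcal{H}}$ satisfies the flat axioms (F1)–(F3).
   Context: $\mathcal{L}(E)$ is the lattice of subspaces of $E$. Hyperplane axioms: (H1) $E\notin\mathcal{H}$; (H2) $H_1,H_2\in\mathcal{H}$, $H_1\subseteq H_2\Rightarrow H_1=H_2$; (H3) for all distinct $H_1,H_2\in\mathcal{H}$ and every $1$-dimensional subspace $x$ there is $H_3\in\mathcal{H}$ with $(H_1\cap H_2)+x\subseteq H_3$. For $A,B$ in a collection $\mathcal{F}$, $B$ covers $A$ in $\mathcal{F}$ if $A\subseteq B$ and no member of $\mathcal{F}$ lies strictly between them. Flat axioms: (F1) $E\in\mathcal{F}$; (F2) $F_1,F_2\in\mathcal{F}\Rightarrow F_1\cap F_2\in\mathcal{F}$; (F3) for every $F\in\mathcal{F}$ and every $1$-dimensional $x\not\subseteq F$ there is a unique cover of $F$ in $\mathcal{F}$ containing $x$. *)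

(* Defs.v *)
From HB Require Import structures.
From mathcomp Require Import all_boot all_order all_algebra.
From mathcomp Require Import boolp classical_sets.

Set Implicit Arguments.
Unset Strict Implicit.
Unset Printing Implicit Defensive.

Import GRing.Theory.
Local Open Scope classical_set_scope.
Local Open Scope ring_scope.

(* Collections of subspaces are classical sets, not finite ones: the ground   *)
(* field may be infinite.                                                     *)
Record hyperplane_axioms (K : fieldType) (E : vectType K)
    (Hs : set {vspace E}) : Prop := HyperplaneAxioms {
  hyperplane_proper : ~ Hs fullv;
  hyperplane_antichain : forall H1 H2 : {vspace E},
    Hs H1 -> Hs H2 -> (H1 <= H2)%VS -> H1 = H2;
  hyperplane_exchange : forall H1 H2 : {vspace E},
    Hs H1 -> Hs H2 -> H1 <> H2 ->
    forall x : {vspace E}, \dim x = 1%N ->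
    exists2 H3 : {vspace E}, Hs H3 & (H1 :&: H2 + x <= H3)%VS
}.

(* As B is only required to contain A, every member of Fs covers itself; this *)
(* does not interfere with flat_cover, where the cover contains x but A does  *)
(* not.                                                                       *)
Definition covers (K : fieldType) (E : vectType K) (Fs : set {vspace E})
    (A B : {vspace E}) : Prop :=
  [/\ Fs A, Fs B, (A <= B)%VS
    & ~ exists C : {vspace E},
        [/\ Fs C, (A <= C)%VS, A <> C, (C <= B)%VS & C <> B]].

Record flat_axioms (K : fieldType) (E : vectType K)
    (Fs : set {vspace E}) : Prop := FlatAxioms {
  flat_full : Fs fullv;
  flat_cap : forall F1 F2 : {vspace E}, Fs F1 -> Fs F2 -> Fs (F1 :&: F2)%VS;
  flat_cover : forall F : {vspace E}, Fs F ->
    forall x : {vspace E}, \dim x = 1%N -> ~ (x <= F)%VS ->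
    exists! B : {vspace E}, covers Fs F B /\ (x <= B)%VS
}.

(* I may be infinite or empty, so the intersection is taken on underlying     *)
(* sets of vectors; for empty I it is the whole of E.                         *)
Definition flats_of (K : fieldType) (E : vectType K)
    (Hs : set {vspace E}) : set {vspace E} :=
  [set F : {vspace E} | exists2 I : set {vspace E},
     I `<=` Hs & [set` F] = \bigcap_(H in I) [set` H]].

(* Main.v *)
Require Import Defs.
From HB Require Import structures.
From mathcomp Require Import all_boot all_order all_algebra.
From mathcomp Require Import boolp classical_sets.

(** A cover of a flat [F] containing [x] must be the closure [B] of [F + x], the
    intersection of the hyperplanes above [F + x].  That [B] does cover [F] is
    the exchange property: if [y] lies in [B] but not in [F], then [x] lies in
    the closure of [F + y].  This follows from a strong form of (H3), in which
    [H3] is moreover required to avoid a given vector of [H1] outside [H2]; as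
    for strong circuit elimination in matroids, it follows from the weak form by
    induction on the codimension of [H1 :&: H2]. *)

Set Implicit Arguments.
Unset Strict Implicit.
Unset Printing Implicit Defensive.

Import GRing.Theory.
Local Open Scope classical_set_scope.
Local Open Scope ring_scope.

Lemma ltn_dimv (K : fieldType) (E : vectType K) (U V : {vspace E}) (v : E) :
  (U <= V)%VS -> v \in V -> v \notin U -> (\dim U < \dim V)%N.
Proof.
move=> sUV vV; rewrite (ltn_leqif (dimv_leqif_sup sUV)).
by apply: contra => /subvP; exact.
Qed.

Lemma dimv1_vline (K : fieldType) (E : vectType K) (x : {vspace E}) :
  \dim x = 1%N -> exists v, x = <[v]>%VS.
Proof.
move=> dx; exists (vpick x); apply/esym/eqP.
rewrite eqEdim -memvE memv_pick dx dim_vline vpick0.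
by case: eqP dx => // ->; rewrite dimv0.
Qed.

(** Finite dimension tames an infinite [I]: cutting [V] by a member of [I] that does not contain it
    lowers the dimension, so the cutting, started from [fullv], stops. *)
Lemma bigcap_vspace (K : fieldType) (E : vectType K) (I : set {vspace E}) :
  exists W : {vspace E}, [set` W] = \bigcap_(H in I) [set` H].
Proof.
suff cap_in n (V : {vspace E}) : (\dim V <= n)%N -> exists W : {vspace E},
    [set` W] = [set` V] `&` \bigcap_(H in I) [set` H].
  have [W eqW] := cap_in _ fullv (leqnn _); exists W; rewrite eqW.
  by rewrite (_ : [set` fullv] = setT) ?setTI // -subTset => v _; exact: memvf.
elim: n V => [|n IHn] V dV.
  exists V; apply/seteqP; split=> v; last by case.
  move: dV; rewrite leqn0 dimv_eq0 => /eqP -> /= v0.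
  by split=> // H _ /=; rewrite (eqP (_ : v == 0)) ?mem0v // -memv0.
have [sVI|] := pselect (forall H, I H -> (V <= H)%VS).
  exists V; apply/seteqP; split=> v; last by case.
  by move=> vV; split=> // H /sVI /subvP; exact.
move=> /existsNP [H /not_implyP [IH /negP nsVH]].
have [|W eqW] := IHn (V :&: H)%VS.
  rewrite -ltnS; apply: leq_trans dV.
  by rewrite (ltn_leqif (dimv_leqif_sup (capvSl V H))) subv_cap subvv.
exists W; rewrite eqW; apply/seteqP; split=> v /=.
  by rewrite memv_cap => -[/andP[]].
by move=> [vV vI]; split=> //; rewrite memv_cap vV; exact: vI.
Qed.

Section Flats.
Variables (K : fieldType) (E : vectType K) (Hs : set {vspace E}).
Implicit Types (F V B C H : {vspace E}) (v e f : E).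

Lemma flats_of_sep F v : flats_of Hs F -> v \notin F ->
  exists H, [/\ Hs H, (F <= H)%VS & v \notin H].
Proof.
move=> [I sIH eqF] vF; apply: contrapT => noH.
have /negP := vF; apply; suff : [set` F] v by [].
rewrite eqF => H IH /=; apply: contrapT => /negP vH; apply: noH.
exists H; split=> //; first exact: sIH.
apply/subvP => u uF; have : [set` F] u by [].
by rewrite eqF; apply.
Qed.

Lemma flats_of_closure V : exists B,
  [/\ flats_of Hs B, (V <= B)%VS & forall H, Hs H -> (V <= H)%VS -> (B <= H)%VS].
Proof.
have [B eqB] := bigcap_vspace [set H | Hs H /\ (V <= H)%VS].
exists B; split; first by exists [set H | Hs H /\ (V <= H)%VS] => // H [].
  apply/subvP => u uV; suff : [set` B] u by [].
  by rewrite eqB => H [_ /subvP]; exact.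
move=> H HH sVH; apply/subvP => u uB; have : [set` B] u by [].
by rewrite eqB; apply.
Qed.

Hypothesis hHs : hyperplane_axioms Hs.

Lemma hyperplane_strong_exchange H1 H2 e f : Hs H1 -> Hs H2 ->
    e \notin H1 -> e \notin H2 -> f \in H1 -> f \notin H2 ->
  exists H3, [/\ Hs H3, (H1 :&: H2 <= H3)%VS, e \in H3 & f \notin H3].
Proof.
have [n] := ubnP (\dim {:E} - \dim (H1 :&: H2)).
elim: n => // n IHn in H1 H2 e f *.
move=> codim_lt HH1 HH2 eH1 eH2 fH1 fH2.
(* Both calls of the induction hypothesis use a pair whose intersection gains a vector over
   [H1 :&: H2]: first [f], then [g]. *)
have codim_ltS U v : (H1 :&: H2 <= U)%VS -> v \in U ->
    v \notin (H1 :&: H2)%VS -> (\dim {:E} - \dim U < n)%N.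
  move=> sU vU vH; rewrite -ltnS; apply: leq_trans codim_lt.
  rewrite ltnS ltn_sub2l ?(ltn_dimv sU vU) //.
  exact: leq_trans (ltn_dimv sU vU vH) (dimvS (subvf U)).
have neq12 : H1 <> H2 by move=> eq12; rewrite -eq12 fH1 in fH2.
have de : \dim <[e]> = 1%N.
  by rewrite dim_vline; case: eqP eH1 => // ->; rewrite mem0v.
have [H3 HH3] := hyperplane_exchange hHs HH1 HH2 neq12 de.
rewrite subv_add -memvE => /andP[s3 eH3].
have [fH3|fH3] := boolP (f \in H3); last by exists H3.
have /subvPn[g gH2 gH3] : ~~ (H2 <= H3)%VS.
  apply/negP => /(hyperplane_antichain hHs HH2 HH3) eq23.
  by rewrite eq23 eH3 in eH2.
have gH1 : g \notin H1.
  by apply: contra gH3 => gH1; apply: (subvP s3); rewrite memv_cap gH1.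
have s13 : (H1 :&: H2 <= H3 :&: H1)%VS by rewrite subv_cap s3 capvSl.
(* [H3] wrongly contains [f]. Exchanging [e] for [g] gives an [H4] that keeps [f] but avoids [e], so
   it can replace [H1], and [H4 :&: H2] now contains [g]. *)
have [|H4 [HH4 s4 gH4 eH4]] := IHn H3 H1 g e _ HH3 HH1 gH3 gH1 eH3 eH1.
  apply: (codim_ltS _ f s13); first by rewrite memv_cap fH3.
  by rewrite memv_cap (negPf fH2) andbF.
have s42 : (H1 :&: H2 <= H4 :&: H2)%VS.
  by rewrite subv_cap (subv_trans s13 s4) capvSr.
have fH4 : f \in H4 by apply: (subvP s4); rewrite memv_cap fH3.
have [|H5 [HH5 s5 eH5 fH5]] := IHn H4 H2 e f _ HH4 HH2 eH4 eH2 fH4 fH2.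
  apply: (codim_ltS _ g s42); first by rewrite memv_cap gH4.
  by rewrite memv_cap (negPf gH1).
by exists H5; split=> //; exact: subv_trans s5.
Qed.

Lemma flats_of_full : flats_of Hs fullv.
Proof.
exists set0; first exact: sub0set.
by rewrite bigcap_set0 -subTset => v _; exact: memvf.
Qed.

Lemma flats_of_cap F C :
  flats_of Hs F -> flats_of Hs C -> flats_of Hs (F :&: C)%VS.
Proof.
move=> [I sI eqF] [J sJ eqC]; exists (I `|` J); first by rewrite subUset.
rewrite bigcap_setU -eqF -eqC; apply/seteqP.
by split=> v /=; rewrite memv_cap => /andP.
Qed.

Lemma flats_of_cover F v : flats_of Hs F -> v \notin F ->
  exists! B, covers (flats_of Hs) F B /\ (<[v]> <= B)%VS.
Proof.
move=> flF vF; have [B [flB]] := flats_of_closure (F + <[v]>).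
rewrite subv_add -memvE => /andP[sFB vB] minB.
(* Minimality of [B] passes from hyperplanes to flats, since a hyperplane above [C] separates [C]
   from any vector outside it. *)
have leB C : flats_of Hs C -> (F <= C)%VS -> v \in C -> (B <= C)%VS.
  move=> flC sFC vC; apply/subvP => u uB; apply: contraT.
  move=> /(flats_of_sep flC)[H [HH sCH]].
  rewrite (subvP (minB H HH _)) // subv_add -memvE (subvP sCH _ vC).
  by rewrite (subv_trans sFC sCH).
exists B; split; last first.
  (* Uniqueness: a cover [B'] other than [B] would have [B] strictly between [F] and itself. *)
  move=> B' [[_ flB' sFB' noC]]; rewrite -memvE => vB'.
  apply: contrapT => neqB; apply: noC; exists B; split=> //.
    by move=> eqFB; rewrite eqFB vB in vF.
  exact: leB.
split; last by rewrite -memvE.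
split=> // -[C [flC sFC neqFC sCB neqCB]].
have /subvPn[y yC yF] : ~~ (C <= F)%VS.
  by apply/negP => sCF; apply: neqFC; apply/eqP; rewrite eqEsubv sFC.
have vC : v \notin C.
  apply/negP => vC; apply: neqCB; apply/eqP.
  by rewrite eqEsubv sCB leB.
have [H1 [HH1 sCH1 vH1]] := flats_of_sep flC vC.
have [H2 [HH2 sFH2 yH2]] := flats_of_sep flF yF.
have above_v H : Hs H -> (F <= H)%VS -> v \in H -> y \in H.
  move=> HH sFH vH; have sBH : (B <= H)%VS.
    by apply: minB; rewrite // subv_add sFH -memvE.
  exact: (subvP (subv_trans sCB sBH)).
have vH2 : v \notin H2 by apply: contra yH2; exact: above_v.
(* The resulting [H3] lies above [F] and contains [v] but not [y], against [above_v]. *)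
have [H3 [HH3 s3 vH3]] := hyperplane_strong_exchange HH1 HH2 vH1 vH2
  (subvP sCH1 _ yC) yH2.
rewrite above_v //; apply: subv_trans s3.
by rewrite subv_cap sFH2 (subv_trans sFC).
Qed.

End Flats.

Theorem theorem65 (K : fieldType) (E : vectType K) (Hs : set {vspace E})
  (hHs : hyperplane_axioms Hs) : flat_axioms (flats_of Hs).
Proof.
split; [exact: flats_of_full | exact: flats_of_cap |].
move=> F flF x /dimv1_vline[v ->]; rewrite -memvE => /negP.
exact: flats_of_cover.
Qed.
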